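(* Let $A\in\mathbb{R}^{m\times n}$ have full rank with $m\ge n$, let $M=A^TA$, let $A_i\in\mathbb{R}^n$ denote the $i$-th row of $A$ (as a column vector), and let $e_i$ denote the $i$-th standard basis vector of $\mathbb{R}^n$. The left and right one-sided optimal diagonal preconditioning problems $$\min_{D_1\succ0}\kappa(D_1^{1/2}A)\quad (D_1\in\mathbb{R}^{m\times m}\text{ diagonal}),\qquad \min_{D_2\succ0}\kappa(AD_2^{-1/2})\quad(D_2\in\mathbb{R}^{n\times n}\text{ diagonal})$$ are equivalent, respectively, to the standard dual semidefinite programs $$\text{(Left)}\quad \max_{\tau\in\mathbb{R},\,d\in\mathbb{R}^m}\ \tau\quad\text{s.t.}\quad \sum_{i=1}^m d_iA_iA_i^T\succeq\tau I_n,\quad I_n\succeq\sum_{i=1}^m d_iA_iA_i^T,\quad d\ge0,$$ $$\text{(Right)}\quad \max_{\tau\in\mathbb{R},\,d\in\mathbb{R}^n}\ \tau\quad\text{s.t.}\quad \sum_{i=1}^n d_ie_ie_i^T\preceq M,\quad \tau M-\sum_{i=1}^n d_ie_ie_i^T\preceq0,\quad d\ge0.$$ Here equivalence means: the optimal value of (Left) equals $\big(\inf_{D_1\succ0}\kappa(D_1^{1/2}A)\big)^{-2}$ and that of (Right) equals $\big(\inf_{D_2\succ0}\kappa(AD_2^{-1/2})\big)^{-2}$; and optimal solutions correspond up to positive scaling through $D_1\propto\mathrm{diag}(d)$ (for (Left), with $D_1\succeq0$ allowed in place of $D_1\succ 0$) and $D_2\propto\mathrm{diag}(d)$ (for (R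ight)).
   Context: For a matrix $B\in\mathbb{R}^{m\times n}$ with $m\ge n$ of full column rank, $\kappa(B)=\sigma_{\max}(B)/\sigma_{\min}(B)$ is the ratio of its largest to its smallest ($n$-th) singular value, so $\kappa(B)^2=\kappa(B^TB)$; if $B$ is rank deficient, $\kappa(B)=+\infty$. $\preceq,\succeq$ denote the Loewner order on symmetric matrices, $\mathrm{diag}(d)$ is the diagonal matrix with diagonal $d$, and $d\ge0$ is entrywise. A semidefinite program is in standard dual (inequality) form if it maximizes a linear function of a vector variable subject to linear matrix inequalities that are affine in that variable. The paper reformulates the right problem as: minimize $\kappa$ subject to $A^TA\succeq D_2$, $\kappa D_2\succeq A^TA$, $D_2\succeq0$ diagonal; and the left problem as: minimize $\kappa$ subject to $A^TD_1A\succeq I_n$, $\kappa I_n\succeq A^TD_1A$, $D_1\succeq0$ diagonal. The changes of variables are $\tau=1/\kappa$ with $d=\mathrm{diag}(D_2)$ (right), and $\tau=1/\kappa$ with $D_1/\kappa=\mathrm{diag}(d)$ (left). *)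

(* Defs.v *)
From HB Require Import structures.
From mathcomp Require Import all_boot all_order all_algebra.
From mathcomp Require Import all_classical all_reals ereal.

Set Implicit Arguments.
Unset Strict Implicit.
Unset Printing Implicit Defensive.
Import Order.TTheory GRing.Theory Num.Theory.
Local Open Scope classical_set_scope.
Local Open Scope ring_scope.

Definition psd (R : realType) (n : nat) (S : 'M[R]_n) : Prop :=
  S^T = S /\ forall x : 'cV[R]_n, 0 <= (x^T *m S *m x) 0 0.

Definition posdef (R : realType) (n : nat) (S : 'M[R]_n) : Prop :=
  S^T = S /\ forall x : 'cV[R]_n, x != 0 -> 0 < (x^T *m S *m x) 0 0.

Definition loewner_le (R : realType) (n : nat) (S T : 'M[R]_n) : Prop :=
  psd (T - S).

(* For m >= n the n singular values of an m x n matrix B are the nonnegative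
   square roots of the eigenvalues of the n x n matrix B^T B. *)
Definition singular_values (R : realType) (m n : nat) (B : 'M[R]_(m, n)) :
    set R :=
  [set s | 0 <= s /\ eigenvalue (B^T *m B) (s ^+ 2)].

(* The set of singular values is finite and, for n > 0, nonempty, so that for
   n > 0 the supremum and infimum below are a maximum and a minimum. *)
Definition sigma_max (R : realType) (m n : nat) (B : 'M[R]_(m, n)) : R :=
  sup (singular_values B).

Definition sigma_min (R : realType) (m n : nat) (B : 'M[R]_(m, n)) : R :=
  inf (singular_values B).

Definition kappa (R : realType) (m n : nat) (B : 'M[R]_(m, n)) : \bar R :=
  if \rank B == n then (sigma_max B / sigma_min B)%:E else +oo%E.

Definition psd_diag (R : realType) (n : nat) : set 'M[R]_n :=
  [set D | is_diag_mx D /\ psd D].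

Definition posdef_diag (R : realType) (n : nat) : set 'M[R]_n :=
  [set D | is_diag_mx D /\ posdef D].

(* The positive semidefinite square root D^{1/2} of a diagonal D that is
   positive semidefinite; only meaningful for such D. *)
Definition diag_sqrt (R : realType) (n : nat) (D : 'M[R]_n) : 'M[R]_n :=
  diag_mx (\row_i Num.sqrt (D i i)).

Definition left_kappa (R : realType) (m n : nat) (A : 'M[R]_(m, n))
    (D1 : 'M[R]_m) : \bar R :=
  kappa (diag_sqrt D1 *m A).

(* [invmx (diag_sqrt D2)] is D2^{-1/2} when D2 is positive definite. *)
Definition right_kappa (R : realType) (m n : nat) (A : 'M[R]_(m, n))
    (D2 : 'M[R]_n) : \bar R :=
  kappa (A *m invmx (diag_sqrt D2)).

Definition minimizer (R : realType) (T : Type) (X : set T) (f : T -> \bar R)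
    (x : T) : Prop :=
  X x /\ forall y : T, X y -> (f x <= f y)%E.

Definition left_feasible (R : realType) (m n : nat) (A : 'M[R]_(m, n))
    (tau : R) (d : 'rV[R]_m) : Prop :=
  let S := \sum_(i < m) d 0 i *: ((row i A)^T *m ((row i A)^T)^T) in
  [/\ loewner_le (tau *: 1%:M) S,
      loewner_le S 1%:M
    & forall i, 0 <= d 0 i].

Definition std_basis (R : realType) (n : nat) (i : 'I_n) : 'cV[R]_n :=
  delta_mx i 0.

Definition right_feasible (R : realType) (m n : nat) (A : 'M[R]_(m, n))
    (tau : R) (d : 'rV[R]_n) : Prop :=
  let M := A^T *m A in
  let S := \sum_(i < n) d 0 i *: (std_basis R i *m (std_basis R i)^T) in
  [/\ loewner_le S M,
      loewner_le (tau *: M - S) 0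
    & forall i, 0 <= d 0 i].

(* The supremum is taken in the extended reals; attainment is a separate
   notion, [max_solution]. *)
Definition max_value (R : realType) (p : nat) (F : R -> 'rV[R]_p -> Prop) :
    \bar R :=
  ereal_sup [set tau%:E | tau in [set tau | exists d, F tau d]].

Definition max_solution (R : realType) (p : nat) (F : R -> 'rV[R]_p -> Prop)
    (tau : R) (d : 'rV[R]_p) : Prop :=
  F tau d /\ forall tau' d', F tau' d' -> tau' <= tau.

Definition from_max_solution (R : realType) (p : nat)
    (F : R -> 'rV[R]_p -> Prop) (D : 'M[R]_p) : Prop :=
  exists (tau : R) (d : 'rV[R]_p) (c : R),
    [/\ max_solution F tau d, 0 < c & D = c *: diag_mx d].

(* A semidefinite program in standard dual form in the variable y in R^p:
   maximize sum_i b_i y_i subject to finitely many linear matrix inequalities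
   C_j + sum_i y_i G_(j,i) >= 0 with symmetric data. *)
Record dual_sdp (R : realType) (p : nat) := DualSDP {
  sdp_obj : 'rV[R]_p;
  sdp_nlmi : nat;
  sdp_dim : 'I_sdp_nlmi -> nat;
  sdp_const : forall j, 'M[R]_(sdp_dim j);
  sdp_coef : forall j, 'I_p -> 'M[R]_(sdp_dim j);
  sdp_const_sym : forall j, (sdp_const j)^T = sdp_const j;
  sdp_coef_sym : forall j i, (sdp_coef j i)^T = sdp_coef j i
}.

Definition sdp_objective (R : realType) (p : nat) (P : dual_sdp R p)
    (y : 'rV[R]_p) : R :=
  \sum_(i < p) sdp_obj P 0 i * y 0 i.

Definition sdp_feasible (R : realType) (p : nat) (P : dual_sdp R p)
    (y : 'rV[R]_p) : Prop :=
  forall j : 'I_(sdp_nlmi P),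
    loewner_le 0 (sdp_const j + \sum_(i < p) y 0 i *: sdp_coef j i).

(* "Maximize tau subject to F tau d" is a standard dual program in the vector
   variable (tau, d). *)
Definition is_dual_sdp (R : realType) (p : nat) (F : R -> 'rV[R]_p -> Prop) :
    Prop :=
  exists P : dual_sdp R (1 + p), forall (tau : R) (d : 'rV[R]_p),
    let y : 'rV[R]_(1 + p) := row_mx tau%:M d in
    sdp_objective P y = tau /\ (sdp_feasible P y <-> F tau d).

(* Main.v *)
Require Import Defs.
From mathcomp Require Import all_boot all_order all_algebra.
From mathcomp Require Import all_classical all_reals ereal.
From mathcomp Require Import ring lra.
Set Implicit Arguments.
Unset Strict Implicit.
Unset Printing Implicit Defensive.
Import Order.TTheory GRing.Theory Num.Theory.
Local Open Scope classical_set_scope.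
Local Open Scope ring_scope.

(** Both equivalences come from one observation about Rayleigh quotients.  For
    B of full column rank, the extreme eigenvalues a and b of B^T B are the best
    constants in a |x|^2 <= |B x|^2 <= b |x|^2, and kappa B = (a / b)^(-1/2).  So
    kappa B <= tau^(-1/2) exactly when some positive multiple c of B^T B
    satisfies tau I <= c B^T B <= I ([kappa_extreme] and [kappa_le]).

    On the left, B = D1^(1/2) A has B^T B = A^T D1 A, and the scalar c is absorbed
    into D1: the condition is feasibility of (tau, c diag D1).  On the right,
    B = A D2^(-1/2), and substituting x = D2^(1/2) y turns the sandwich into
    a D2 <= A^T A <= b D2, which is feasibility of (a / b, a diag D2).  Thus every
    preconditioner with finite kappa gives a feasible point with
    tau = kappa^(-2), and every feasible point with tau > 0 gives a
    preconditioner with kappa <= tau^(-1/2), the two diagonals being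
    proportional.  This two-way passage is [value_transfer]; equality of the
    values ([max_value_transfer]) and the correspondence of the optimal
    solutions ([minimizer_transfer]) follow from it by order arguments alone.

    A feasible d of the left program may have zero entries, so the left problem
    transfers to D1 >= 0.  Adding a small multiple of the identity to D1 changes
    kappa arbitrarily little, hence the infimum over D1 > 0 is the same
    ([left_density]), although it need not be attained there.

    The extreme eigenvalues are obtained without compactness or the spectral
    theorem: the supremum l of the Rayleigh quotient of S is an eigenvalue,
    because otherwise l I - S would be positive semidefinite and invertible,
    hence bounded below by a positive multiple of I ([psd_unit_coercive]),
    and l could be lowered. *)

(** * Quadratic forms *)

Definition qform {R : realType} {n : nat} (S : 'M[R]_n) (x : 'cV[R]_n) : R :=
  (x^T *m S *m x) 0 0.

Definition normsq {R : realType} {n : nat} (x : 'cV[R]_n) : R := (x^T *m x) 0 0.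

Lemma normsqE (R : realType) (n : nat) (x : 'cV[R]_n) :
  normsq x = \sum_i x i 0 ^+ 2.
Proof. by rewrite /normsq mxE; apply: eq_bigr => i _; rewrite !mxE expr2. Qed.

Lemma normsq_ge0 (R : realType) (n : nat) (x : 'cV[R]_n) : 0 <= normsq x.
Proof. by rewrite normsqE; apply: sumr_ge0 => i _; apply: sqr_ge0. Qed.

Lemma normsq_eq0 (R : realType) (n : nat) (x : 'cV[R]_n) :
  (normsq x == 0) = (x == 0).
Proof.
apply/eqP/eqP => [|->]; last by rewrite /normsq mulmx0 mxE.
rewrite normsqE => /eqP; rewrite psumr_eq0 => [/allP h|i _]; last exact: sqr_ge0.
apply/colP => i; rewrite mxE.
by have := h i (mem_index_enum i); rewrite /= sqrf_eq0 => /eqP.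
Qed.

Lemma normsq_gt0 (R : realType) (n : nat) (x : 'cV[R]_n) :
  (0 < normsq x) = (x != 0).
Proof. by rewrite lt_def normsq_ge0 andbT normsq_eq0. Qed.

Lemma qformD (R : realType) (n : nat) (S T : 'M[R]_n) (x : 'cV[R]_n) :
  qform (S + T) x = qform S x + qform T x.
Proof. by rewrite /qform mulmxDr mulmxDl mxE. Qed.

Lemma qformZ (R : realType) (n : nat) (c : R) (S : 'M[R]_n) (x : 'cV[R]_n) :
  qform (c *: S) x = c * qform S x.
Proof. by rewrite /qform -scalemxAr -scalemxAl mxE. Qed.

Lemma qformN (R : realType) (n : nat) (S : 'M[R]_n) (x : 'cV[R]_n) :
  qform (- S) x = - qform S x.
Proof. by rewrite -scaleN1r qformZ mulN1r. Qed.

Lemma qformB (R : realType) (n : nat) (S T : 'M[R]_n) (x : 'cV[R]_n) :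
  qform (S - T) x = qform S x - qform T x.
Proof. by rewrite qformD qformN. Qed.

Lemma qform0 (R : realType) (n : nat) (x : 'cV[R]_n) : qform 0 x = 0.
Proof. by rewrite -(scale0r (0 : 'M_n)) qformZ mul0r. Qed.

Lemma qform1 (R : realType) (n : nat) (x : 'cV[R]_n) : qform 1%:M x = normsq x.
Proof. by rewrite /qform mulmx1. Qed.

Lemma qform_congr (R : realType) (m n : nat) (S : 'M[R]_m) (B : 'M[R]_(m, n))
    (x : 'cV[R]_n) :
  qform (B^T *m S *m B) x = qform S (B *m x).
Proof. by rewrite /qform trmx_mul !mulmxA. Qed.

Lemma qform_gram (R : realType) (m n : nat) (B : 'M[R]_(m, n)) (x : 'cV[R]_n) :
  qform (B^T *m B) x = normsq (B *m x).
Proof. by rewrite /qform /normsq trmx_mul !mulmxA. Qed.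

Lemma qform_diag (R : realType) (n : nat) (d : 'rV[R]_n) (x : 'cV[R]_n) :
  qform (diag_mx d) x = \sum_i d 0 i * x i 0 ^+ 2.
Proof.
rewrite /qform mul_mx_diag mxE; apply: eq_bigr => i _; rewrite !mxE; ring.
Qed.

Lemma loewner_leP (R : realType) (n : nat) (S T : 'M[R]_n) :
  S^T = S -> T^T = T ->
  loewner_le S T <-> forall x, qform S x <= qform T x.
Proof.
move=> symS symT; split=> [[_ h] x|h].
  by have := h x; rewrite -/(qform (T - S) x) qformB subr_ge0.
split=> [|x]; first by rewrite linearB /= symS symT.
by rewrite -/(qform (T - S) x) qformB subr_ge0.
Qed.

(** The entrywise bound x_i S_ij x_j <= |S_ij| |x|^2 gives an explicit C; the
    summand 1 in C only serves to make C positive. *)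
Lemma qform_le_normsq (R : realType) (n : nat) (S : 'M[R]_n) :
  exists2 C : R, 0 < C & forall x, qform S x <= C * normsq x.
Proof.
pose C := 1 + \sum_i \sum_j `|S i j|.
exists C => [|x].
  by rewrite ltr_pwDl // sumr_ge0 // => i _; rewrite sumr_ge0.
have xi i : x i 0 ^+ 2 <= normsq x.
  rewrite normsqE (bigD1 i) //= lerDl sumr_ge0 // => j _; exact: sqr_ge0.
have term i j : x i 0 * S i j * x j 0 <= `|S i j| * normsq x.
  apply: (le_trans (ler_norm _)); rewrite !normrM mulrAC mulrC.
  rewrite ler_wpM2l //.
  have := xi i; have := xi j.
  rewrite -(real_normK (num_real (x i 0))) -(real_normK (num_real (x j 0))).
  by have := sqr_ge0 (`|x i 0| - `|x j 0|); nra.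
apply: (@le_trans _ _ ((\sum_i \sum_j `|S i j|) * normsq x)); last first.
  by rewrite ler_wpM2r ?normsq_ge0 // lerDr.
rewrite exchange_big /= mulr_suml /qform mxE; apply: ler_sum => j _.
by rewrite mxE !mulr_suml; apply: ler_sum => i _; rewrite mxE.
Qed.

(** * Extreme eigenvalues *)

(** With S y = x and t > 0, expanding 0 <= q (x - t y) for the form q of S gives
    q x >= 2 t |x|^2 - t^2 x^T S^-1 x; if C bounds the form of S^-1, the choice
    t = 1 / C makes the right-hand side at least |x|^2 / C. *)
Lemma psd_unit_coercive (R : realType) (n : nat) (S : 'M[R]_n) :
  psd S -> S \in unitmx -> exists2 e : R, 0 < e & forall x, e * normsq x <= qform S x.
Proof.
move=> [symS S0] uS; have [C C0 hC] := qform_le_normsq (invmx S).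
exists C^-1 => [|x]; first by rewrite invr_gt0.
pose y := invmx S *m x; pose t := C^-1.
have Sy : S *m y = x by rewrite /y mulmxA mulmxV // mul1mx.
have Sy' : y^T *m S = x^T by rewrite -{1}symS -trmx_mul Sy.
have := S0 (x - t *: y).
have -> : ((x - t *: y)^T *m S *m (x - t *: y)) 0 0
    = qform S x - 2 * t * normsq x + t ^+ 2 * qform (invmx S) x.
  have -> : qform (invmx S) x = (y^T *m x) 0 0.
    by rewrite /qform -mulmxA -/y -[x^T *m y]trmxK trmx_mul trmxK mxE.
  have -> : (x - t *: y)^T *m S = x^T *m S - t *: x^T.
    by rewrite linearB linearZ /= mulmxBl -scalemxAl Sy'.
  rewrite /normsq /qform mulmxBl !mulmxBr -!scalemxAl -!scalemxAr.
  rewrite -[x^T *m S *m y]mulmxA Sy -[x^T *m y]trmxK trmx_mul trmxK.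
  by rewrite !mxE; ring.
have : t ^+ 2 * qform (invmx S) x <= t * normsq x.
  have -> : t * normsq x = t ^+ 2 * (C * normsq x).
    by rewrite expr2 -mulrA (mulrA t C) [t * C]mulVf ?mul1r ?gt_eqF.
  by rewrite ler_wpM2l ?sqr_ge0.
rewrite -/t; lra.
Qed.

Lemma eigenvalue_witness (R : realType) (n : nat) (S : 'M[R]_n) (l : R) :
  S^T = S -> eigenvalue S l ->
  exists2 x : 'cV[R]_n, x != 0 & qform S x = l * normsq x.
Proof.
move=> symS /eigenvalueP[v vS v0]; exists v^T; first by rewrite trmx_eq0.
by rewrite /qform /normsq trmxK vS -scalemxAl mxE.
Qed.

(** The supremum of the Rayleigh quotient is an eigenvalue: if l I - S were
    invertible, coercivity of l I - S would push the quotient below l - e. *)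
Lemma exists_max_eigenvalue (R : realType) (n : nat) (S : 'M[R]_n) :
  (0 < n)%N -> S^T = S ->
  exists2 l, eigenvalue S l & forall x, qform S x <= l * normsq x.
Proof.
move=> n0 symS; have [C _ hC] := qform_le_normsq S.
pose E := [set r | exists2 x : 'cV[R]_n, x != 0 & r = qform S x / normsq x].
have E0 : E !=set0.
  pose u : 'cV[R]_n := const_mx 1; exists (qform S u / normsq u), u => //.
  by apply/eqP => /matrixP/(_ (Ordinal n0) 0)/eqP; rewrite !mxE oner_eq0.
have EC : has_ubound E.
  exists C => _ [x x0 ->]; rewrite ler_pdivrMr ?normsq_gt0 //.
pose l := sup E.
have hl x : qform S x <= l * normsq x.
  have [->|x0] := eqVneq x 0.
    by rewrite /qform /normsq !mulmx0 mxE mulr0.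
  rewrite -ler_pdivrMr ?normsq_gt0 //; apply: ub_le_sup => //; by exists x.
exists l => //.
have psdlS : psd (l%:M - S).
  split=> [|x]; first by rewrite linearB /= tr_scalar_mx symS.
  rewrite -[X in 0 <= X]/(qform (l%:M - S) x) qformB -scalemx1 qformZ qform1.
  by rewrite subr_ge0.
rewrite /eigenvalue /eigenspace kermx_eq0 row_free_unit; apply/negP => uS.
have /(psd_unit_coercive psdlS)[e e0 he] : l%:M - S \in unitmx.
  by rewrite -opprB -scaleN1r unitmxZ // unitrN1.
(* Coercivity makes l - e an upper bound of the quotients. *)
have : l <= l - e.
  apply: ge_sup => // _ [x x0 ->].
  rewrite ler_pdivrMr ?normsq_gt0 //.
  by have := he x; rewrite qformB -scalemx1 qformZ qform1; lra.
by lra.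
Qed.

Lemma exists_min_eigenvalue (R : realType) (n : nat) (S : 'M[R]_n) :
  (0 < n)%N -> S^T = S ->
  exists2 l, eigenvalue S l & forall x, l * normsq x <= qform S x.
Proof.
move=> n0 symS; have symNS : (- S)^T = - S by rewrite linearN /= symS.
have [l /eigenvalueP[v vS v0] hl] := exists_max_eigenvalue n0 symNS.
exists (- l) => [|x]; last by have := hl x; rewrite qformN; lra.
apply/eigenvalueP; exists v => //.
by rewrite scaleNr -vS mulmxN opprK.
Qed.

(** * The condition number *)

(** Every squared singular value is an eigenvalue of B^T B, so it lies between
    the two extreme ones; the supremum and infimum of the singular values are
    therefore attained at their square roots. *)
Lemma sigma_extreme (R : realType) (m n : nat) (B : 'M[R]_(m, n)) :
  (0 < n)%N ->
  exists a b,
    [/\ eigenvalue (B^T *m B) a, eigenvalue (B^T *m B) b,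
        forall x, a * normsq x <= normsq (B *m x) <= b * normsq x,
        sigma_min B = Num.sqrt a & sigma_max B = Num.sqrt b].
Proof.
move=> n0.
have symG : (B^T *m B)^T = B^T *m B by rewrite trmx_mul trmxK.
have [a ea ha] := exists_min_eigenvalue n0 symG.
have [b eb hb] := exists_max_eigenvalue n0 symG.
have eig_ab l : eigenvalue (B^T *m B) l -> a <= l <= b.
  move=> /(eigenvalue_witness symG)[x x0 xl].
  rewrite -(ler_pM2r (_ : 0 < normsq x)) ?normsq_gt0 //.
  rewrite -[X in _ && X](ler_pM2r (_ : 0 < normsq x)) ?normsq_gt0 //.
  by rewrite -xl ha hb.
have eig_ge0 l : eigenvalue (B^T *m B) l -> 0 <= l.
  move=> /(eigenvalue_witness symG)[x x0]; rewrite qform_gram => xl.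
  by rewrite -(pmulr_lge0 _ (_ : 0 < normsq x)) ?normsq_gt0 // -xl normsq_ge0.
have svE l : eigenvalue (B^T *m B) l -> singular_values B (Num.sqrt l).
  by move=> el; split; rewrite ?sqrtr_ge0 // sqr_sqrtr ?eig_ge0.
have sv_ab s : singular_values B s -> Num.sqrt a <= s <= Num.sqrt b.
  move=> [s0 /eig_ab /andP[as_ sb]].
  by rewrite -[s]ger0_norm // -sqrtr_sqr !ler_wsqrtr.
exists a, b; split=> //.
- by move=> x; rewrite -qform_gram ha hb.
- apply/le_anti/andP; split; first apply: ge_inf (svE _ ea).
    by exists (Num.sqrt a) => s /sv_ab /andP[].
  by apply: lb_le_inf => [|s /sv_ab /andP[]//]; exists (Num.sqrt a); apply: svE.
- apply/le_anti/andP; split; last apply: ub_le_sup (svE _ eb).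
    by apply: ge_sup => [|s /sv_ab /andP[]//]; exists (Num.sqrt b); apply: svE.
  by exists (Num.sqrt b) => s /sv_ab /andP[].
Qed.

Lemma injective_full_rank (R : realType) (m n : nat) (B : 'M[R]_(m, n)) :
  \rank B = n <-> forall x : 'cV[R]_n, B *m x = 0 -> x = 0.
Proof.
rewrite -mxrank_tr; split=> [rB x Bx|inj].
  have freeBT : row_free B^T by apply/eqP.
  apply: trmx_inj; apply: (row_free_inj freeBT).
  by rewrite -trmx_mul Bx !trmx0 mul0mx.
apply/eqP; apply: inj_row_free => v vB.
by rewrite -[v]trmxK (inj v^T) ?trmx0 // -[B]trmxK -trmx_mul vB trmx0.
Qed.

(** The vectors attaining the two bounds show that a and b are optimal; this is
    what makes [kappa_le] a consequence. *)
Lemma kappa_extreme (R : realType) (m n : nat) (B : 'M[R]_(m, n)) :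
  (0 < n)%N -> \rank B = n ->
  exists a b,
    [/\ 0 < a <= b,
        forall x, a * normsq x <= normsq (B *m x) <= b * normsq x,
        exists2 x, x != 0 & normsq (B *m x) = a * normsq x,
        exists2 x, x != 0 & normsq (B *m x) = b * normsq x
      & kappa B = (Num.sqrt (a / b))^-1%:E].
Proof.
move=> n0 rB; have [a [b [ea eb hab smin smax]]] := sigma_extreme B n0.
have symG : (B^T *m B)^T = B^T *m B by rewrite trmx_mul trmxK.
have [x x0] := eigenvalue_witness symG ea; rewrite qform_gram => xa.
have [y y0] := eigenvalue_witness symG eb; rewrite qform_gram => yb.
have N0 : 0 < normsq x by rewrite normsq_gt0.
have a0 : 0 < a.
  rewrite -(pmulr_lgt0 _ N0) -xa normsq_gt0; apply: contra x0 => /eqP Bx.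
  by apply/eqP; move/injective_full_rank: rB; apply.
have ab : a <= b by rewrite -(ler_pM2r N0) -xa; case/andP: (hab x).
exists a, b; split=> //; [by rewrite a0|by exists x|by exists y|].
rewrite /kappa rB eqxx smin smax sqrtrM ?(ltW a0) // sqrtrV ?(le_trans (ltW a0)) //.
by rewrite invfM invrK mulrC.
Qed.

Lemma ler_inv_sqrt (R : realType) (s t : R) :
  0 < s -> s <= t -> (Num.sqrt t)^-1 <= (Num.sqrt s)^-1.
Proof.
move=> s0 st; rewrite lef_pV2 ?posrE ?sqrtr_gt0 ?ler_wsqrtr //.
exact: lt_le_trans st.
Qed.

(** Any other sandwich is looser than the optimal one: test it on the vectors that
    attain the optimal bounds.  Positivity of a forces full rank. *)
Lemma kappa_le (R : realType) (m n : nat) (B : 'M[R]_(m, n)) (a b : R) :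
  (0 < n)%N -> 0 < a ->
  (forall x, a * normsq x <= normsq (B *m x) <= b * normsq x) ->
  (kappa B <= (Num.sqrt (a / b))^-1%:E)%E.
Proof.
move=> n0 a0 hab.
have rB : \rank B = n.
  apply/injective_full_rank => x Bx; apply/eqP; rewrite -normsq_eq0.
  have := hab x; rewrite Bx {2}/normsq mulmx0 mxE pmulr_rle0 // => /andP[Nx _].
  by rewrite eq_le Nx normsq_ge0.
have [a' [b' [/andP[a'0 ab'] _ [x x0 xa] [y y0 yb] ->]]] := kappa_extreme n0 rB.
have aa' : a <= a'.
  by rewrite -(ler_pM2r (_ : 0 < normsq x)) ?normsq_gt0 // -xa; case/andP: (hab x).
have b'b : b' <= b.
  by rewrite -(ler_pM2r (_ : 0 < normsq y)) ?normsq_gt0 // -yb; case/andP: (hab y).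
have b'0 : 0 < b' by exact: lt_le_trans ab'.
have b0 : 0 < b by exact: lt_le_trans b'b.
rewrite lee_fin; apply: ler_inv_sqrt; first by rewrite divr_gt0.
by rewrite ler_pM ?invr_ge0 ?(ltW a0) ?(ltW b0) // lef_pV2 ?posrE.
Qed.

(** * Transfer of values and solutions *)

Lemma le_inv_sqrt (R : realType) (r t : R) :
  0 < r -> 0 < t -> (r <= (Num.sqrt t)^-1) = (t <= r^-1 ^+ 2).
Proof.
move=> r0 t0; have r'0 : 0 <= r^-1 by rewrite invr_ge0 ltW.
rewrite -[r in LHS]invrK lef_pV2 ?posrE ?invr_gt0 ?sqrtr_gt0 //.
by rewrite -{1}(ger0_norm r'0) -sqrtr_sqr ler_sqrt ?sqr_ge0.
Qed.

(** The bridge between minimizing f over X and maximizing tau subject to F: a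
    candidate D with finite f D yields a feasible point proportional to D that
    certifies its exact value, and a feasible point with tau > 0 yields candidates
    at least as good as tau^(-1/2), whatever the scaling c.  The third clause
    makes the infimum of f finite and the supremum of tau positive. *)
Definition value_transfer {R : realType} {p : nat} (X : set 'M[R]_p)
    (f : 'M[R]_p -> \bar R) (F : R -> 'rV[R]_p -> Prop) : Prop :=
  [/\ forall D, X D -> f D = +oo%E \/
        exists tau d c, [/\ 0 < tau <= 1, F tau d, 0 < c,
          D = c *: diag_mx d & f D = (Num.sqrt tau)^-1%:E],
      forall tau d c, 0 < tau -> F tau d -> 0 < c ->
        X (c *: diag_mx d) /\ (f (c *: diag_mx d) <= (Num.sqrt tau)^-1%:E)%E
    & exists tau d, 0 < tau /\ F tau d].

Lemma ereal_inf_transfer (R : realType) (p : nat) (X : set 'M[R]_p)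
    (f : 'M[R]_p -> \bar R) (F : R -> 'rV[R]_p -> Prop) :
  value_transfer X f F ->
  exists2 r, 1 <= r & ereal_inf (f @` X) = r%:E.
Proof.
move=> [low upp [tau0 [d0 [t0 F0]]]].
have inf1 : (1 <= ereal_inf (f @` X))%E.
  apply: le_ereal_inf_tmp => _ [D /low[->|[tau [d [c [/andP[s0 s1] _ _ _ ->]]]]] <-].
    exact: leey.
  by rewrite lee_fin le_inv_sqrt // invr1 expr1n.
have [XD fD] := upp _ _ _ t0 F0 ltr01.
have infy : (ereal_inf (f @` X) <= (Num.sqrt tau0)^-1%:E)%E.
  apply: le_trans fD; apply: ereal_inf_lbound; exact: imageP.
move: inf1 infy; case: (ereal_inf _) => [r| |]; rewrite ?lee_fin //.
by exists r.
Qed.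

(** Each inequality between the two values uses one direction of the transfer. *)
Lemma max_value_transfer (R : realType) (p : nat) (X : set 'M[R]_p)
    (f : 'M[R]_p -> \bar R) (F : R -> 'rV[R]_p -> Prop) :
  value_transfer X f F ->
  max_value F = ((ereal_inf (f @` X))^-1 ^+ 2)%E.
Proof.
move=> T; have [r r1 infE] := ereal_inf_transfer T; have [low upp ne] := T.
have r0 : 0 < r by exact: lt_le_trans ltr01 r1.
rewrite infE inver gt_eqF // -EFin_expe.
have maxle : (max_value F <= (r^-1 ^+ 2)%:E)%E.
  apply: ge_ereal_sup => _ [tau [d Fd] <-]; rewrite lee_fin.
  have [t0|t0] := leP tau 0; first exact: le_trans t0 (sqr_ge0 _).
  rewrite -le_inv_sqrt // -lee_fin -infE.
  have [XD fD] := upp _ _ _ t0 Fd ltr01; apply: le_trans fD.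
  by apply: ereal_inf_lbound; exact: imageP.
have maxge tau d : F tau d -> (tau%:E <= max_value F)%E.
  by move=> Fd; apply: ereal_sup_ubound; exists tau => //; exists d.
case E : (max_value F) maxle maxge => [s| |]; last 2 first.
- by rewrite leye_eq.
- by case: ne => tau [d [_ Fd]] _ /(_ _ _ Fd); rewrite leeNy_eq.
rewrite lee_fin => sr smax; apply/eqP; rewrite eqe eq_le sr /=.
have s0 : 0 < s.
  by case: ne => tau [d [t0 /smax]]; rewrite lee_fin; exact: lt_le_trans.
have -> : s = ((Num.sqrt s)^-1)^-1 ^+ 2 by rewrite invrK sqr_sqrtr ?ltW.
rewrite lerXn2r ?nnegrE ?invr_ge0 ?sqrtr_ge0 ?(ltW r0) //.
rewrite lef_pV2 ?posrE ?invr_gt0 ?sqrtr_gt0 // -lee_fin -infE.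
apply: le_ereal_inf_tmp => _ [D XD <-].
have [->|[tau [d [c [/andP[t0 _] Fd _ _ ->]]]]] := low D XD; first exact: leey.
rewrite lee_fin ler_inv_sqrt // -lee_fin; exact: smax Fd.
Qed.

Lemma minimizerE (R : realType) (T : Type) (X : set T) (f : T -> \bar R) (x : T) :
  minimizer X f x <-> X x /\ f x = ereal_inf (f @` X).
Proof.
split=> [[Xx fx]|[Xx fx]]; split=> //.
  apply/le_anti/andP; split; last by apply: ereal_inf_lbound; exact: imageP.
  by apply: le_ereal_inf_tmp => _ [y Xy <-]; exact: fx.
by move=> y Xy; rewrite fx; apply: ereal_inf_lbound; exact: imageP.
Qed.

Lemma minimizer_transfer (R : realType) (p : nat) (X : set 'M[R]_p)
    (f : 'M[R]_p -> \bar R) (F : R -> 'rV[R]_p -> Prop) (D : 'M[R]_p) :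
  value_transfer X f F ->
  minimizer X f D <-> from_max_solution F D.
Proof.
move=> [low upp [tau0 [d0 [t0 F0]]]]; split.
  move=> [XD minD].
  have [XD0 fD0] := upp _ _ _ t0 F0 ltr01.
  have [fD|[tau [d [c [/andP[tau_gt0 _] Fd c0 DE fD]]]]] := low D XD.
    by move: (le_trans (minD _ XD0) fD0); rewrite fD leye_eq.
  exists tau, d, c; split=> //; split=> // tau' d' Fd'.
  have [t'0|t'0] := leP tau' 0; first exact: le_trans t'0 (ltW tau_gt0).
  have [XD' fD'] := upp _ _ _ t'0 Fd' ltr01.
  have := le_trans (minD _ XD') fD'.
  by rewrite fD lee_fin lef_pV2 ?posrE ?sqrtr_gt0 // ler_sqrt // ltW.
move=> [tau [d [c [[Fd maxd] c0 ->]]]].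
have tau_gt0 : 0 < tau by exact: lt_le_trans (maxd _ _ F0).
have [XD fD] := upp _ _ _ tau_gt0 Fd c0; split=> // D' XD'.
have [->|[tau' [d' [c' [/andP[t'0 _] Fd' _ _ ->]]]]] := low D' XD'.
  exact: leey.
apply: le_trans fD _; rewrite lee_fin; apply: ler_inv_sqrt => //; exact: maxd Fd'.
Qed.

(** * Diagonal matrices *)

Lemma qform_diag_delta (R : realType) (n : nat) (d : 'rV[R]_n) (i : 'I_n) :
  qform (diag_mx d) (delta_mx i 0) = d 0 i.
Proof.
rewrite qform_diag (bigD1 i) //= big1 => [|j ji].
  by rewrite !mxE !eqxx expr1n mulr1 addr0.
by rewrite !mxE (negPf ji) expr0n mulr0.
Qed.

Lemma psd_diagP (R : realType) (n : nat) (D : 'M[R]_n) :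
  psd_diag D <-> exists2 d, D = diag_mx d & forall i, 0 <= d 0 i.
Proof.
split=> [[/diag_mxP[d ->] [_ q0]]|[d -> d0]].
  by exists d => // i; rewrite -qform_diag_delta; exact: q0.
split; first exact: diag_mx_is_diag; split=> [|x]; first exact: tr_diag_mx.
rewrite -/(qform _ x) qform_diag sumr_ge0 // => i _.
by rewrite mulr_ge0 ?sqr_ge0.
Qed.

Lemma posdef_diagP (R : realType) (n : nat) (D : 'M[R]_n) :
  posdef_diag D <-> exists2 d, D = diag_mx d & forall i, 0 < d 0 i.
Proof.
split=> [[/diag_mxP[d ->] [_ q0]]|[d -> d0]].
  exists d => // i; rewrite -qform_diag_delta; apply: q0.
  by apply/eqP => /matrixP/(_ i 0)/eqP; rewrite !mxE !eqxx oner_eq0.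
split; first exact: diag_mx_is_diag; split=> [|x x0]; first exact: tr_diag_mx.
rewrite -/(qform _ x) qform_diag lt_def sumr_ge0 ?andbT => [|i _]; last first.
  by rewrite mulr_ge0 ?sqr_ge0 ?ltW.
apply: contra x0; rewrite psumr_eq0 => [/allP h|i _]; last first.
  by rewrite mulr_ge0 ?sqr_ge0 ?ltW.
apply/eqP/colP => i; rewrite mxE; apply/eqP.
have := h i (mem_index_enum i).
by rewrite /= mulf_eq0 gt_eqF //= sqrf_eq0.
Qed.

Lemma diag_sqrtE (R : realType) (n : nat) (d : 'rV[R]_n) :
  diag_sqrt (diag_mx d) = diag_mx (map_mx Num.sqrt d).
Proof.
by congr diag_mx; apply/rowP => i; rewrite !mxE eqxx mulr1n.
Qed.

Lemma normsq_diag_sqrt (R : realType) (n : nat) (D : 'M[R]_n) (x : 'cV[R]_n) :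
  psd_diag D -> normsq (diag_sqrt D *m x) = qform D x.
Proof.
move=> /psd_diagP[d -> d0]; rewrite diag_sqrtE qform_diag normsqE.
apply: eq_bigr => i _.
by rewrite mul_diag_mx !mxE exprMn sqr_sqrtr.
Qed.

Lemma posdef_psd_diag (R : realType) (n : nat) :
  @posdef_diag R n `<=` @psd_diag R n.
Proof.
by move=> D /posdef_diagP[d -> d0]; apply/psd_diagP; exists d => // i; exact: ltW.
Qed.

Lemma diag_sqrt_unit (R : realType) (n : nat) (D : 'M[R]_n) :
  posdef_diag D -> diag_sqrt D \in unitmx.
Proof.
move=> /posdef_diagP[d -> d0]; rewrite diag_sqrtE unitmxE det_diag unitfE.
by apply/prodf_neq0 => i _; rewrite mxE sqrtr_eq0 -ltNge.
Qed.

(** * The left problem *)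

Lemma sum_rows_outer (R : realType) (m n : nat) (A : 'M[R]_(m, n)) (d : 'rV[R]_m) :
  \sum_(i < m) d 0 i *: ((row i A)^T *m ((row i A)^T)^T)
  = A^T *m diag_mx d *m A.
Proof.
apply/matrixP => j k; rewrite mul_mx_diag summxE mxE; apply: eq_bigr => i _.
rewrite !mxE big_ord_recl big_ord0 addr0 !mxE; ring.
Qed.

Lemma left_feasibleP (R : realType) (m n : nat) (A : 'M[R]_(m, n)) (tau : R)
    (d : 'rV[R]_m) :
  left_feasible A tau d <->
  (forall x, tau * normsq x <= qform (diag_mx d) (A *m x) <= normsq x)
  /\ forall i, 0 <= d 0 i.
Proof.
rewrite /left_feasible sum_rows_outer.
have symS : (A^T *m diag_mx d *m A)^T = A^T *m diag_mx d *m A.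
  by rewrite !trmx_mul trmxK tr_diag_mx mulmxA.
have symI c : (c *: 1%:M : 'M[R]_n)^T = c *: 1%:M by rewrite linearZ /= trmx1.
have symI1 := trmx1 R n.
split=> [[/(loewner_leP (symI tau) symS) h1 /(loewner_leP symS symI1) h2 d0]|[h d0]].
  split=> // x; have := h1 x; have := h2 x.
  by rewrite qformZ !qform1 qform_congr => -> ->.
split=> //; apply/loewner_leP => // x; rewrite ?qformZ qform1 qform_congr.
  by case/andP: (h x).
by case/andP: (h x).
Qed.

(** From D to the program, d is diag D divided by the largest eigenvalue b of
    A^T D A, so that the upper constraint is tight and tau = a / b. *)
Lemma left_transfer (R : realType) (m n : nat) (A : 'M[R]_(m, n)) :
  (0 < n)%N -> \rank A = n ->
  value_transfer (@psd_diag R m) (left_kappa A) (left_feasible A).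
Proof.
move=> n0 rA; split.
- move=> D XD; rewrite /left_kappa.
  have [rB|rB] := eqVneq (\rank (diag_sqrt D *m A)) n; last first.
    by left; rewrite /kappa (negPf rB).
  right; have [a [b [/andP[a0 ab] hab _ _ kE]]] := kappa_extreme n0 rB.
  have b0 : 0 < b by exact: lt_le_trans ab.
  have /psd_diagP[d DE d0] := XD.
  exists (a / b), (b^-1 *: d), b; split=> //.
  + by rewrite divr_gt0 //= ler_pdivrMr // mul1r.
  + apply/left_feasibleP; split=> [x|i]; last first.
      by rewrite mxE mulr_ge0 ?invr_ge0 ?(ltW b0).
    have := hab x; rewrite -mulmxA normsq_diag_sqrt // => /andP[h1 h2].
    rewrite linearZ /= -DE qformZ -(ler_pM2l b0) mulrA mulrCA mulfV ?gt_eqF // mulr1.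
    rewrite -[X in _ && X](ler_pM2l b0) mulrA mulfV ?gt_eqF // mul1r.
    by rewrite h1 h2.
  + by rewrite linearZ /= scalerA mulfV ?gt_eqF // scale1r -DE.
- move=> tau d c t0 /left_feasibleP[hd d0] c0.
  have XD : psd_diag (c *: diag_mx d).
    apply/psd_diagP; exists (c *: d); first by rewrite linearZ.
    by move=> i; rewrite mxE mulr_ge0 ?(ltW c0).
  split=> //; have -> : tau = c * tau / c by rewrite mulrAC mulfV ?mul1r ?gt_eqF.
  apply: kappa_le => //; first by rewrite mulr_gt0.
  move=> x; rewrite -mulmxA normsq_diag_sqrt // qformZ -mulrA.
  by rewrite !ler_pM2l.
- have [a [b [/andP[a0 ab] hab _ _ _]]] := kappa_extreme n0 rA.
  have b0 : 0 < b by exact: lt_le_trans ab.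
  exists (a / b), (const_mx b^-1); split; first by rewrite divr_gt0.
  apply/left_feasibleP; split=> [x|i]; last by rewrite mxE invr_ge0 ltW.
  have /andP[h1 h2] := hab x.
  rewrite diag_const_mx -scalemx1 qformZ qform1 mulrAC [b^-1 * _]mulrC.
  by rewrite ler_pM2r ?invr_gt0 // h1 ler_pdivrMr // mulrC.
Qed.

(** If a, b are the sandwich constants of D^(1/2) A and |A x|^2 <= C |x|^2, then
    D + (e / C) I has sandwich constants a and b + e; let e tend to 0. *)
Lemma left_density (R : realType) (m n : nat) (A : 'M[R]_(m, n)) :
  (0 < n)%N -> \rank A = n ->
  ereal_inf (left_kappa A @` @posdef_diag R m)
  = ereal_inf (left_kappa A @` @psd_diag R m).
Proof.
move=> n0 rA; set J := ereal_inf (left_kappa A @` @posdef_diag R m).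
have infJ : (ereal_inf (left_kappa A @` @psd_diag R m) <= J)%E.
  apply: ereal_inf_le_tmp => _ [D /posdef_psd_diag XD <-]; exact: imageP.
apply/eqP; rewrite eq_le infJ andbT.
have [r0 r01 infE] := ereal_inf_transfer (left_transfer n0 rA).
rewrite infE in infJ.
have [a0 [C [/andP[a00 aC] hC _ _ _]]] := kappa_extreme n0 rA.
have C0 : 0 < C by exact: lt_le_trans aC.
apply: le_ereal_inf_tmp => _ [D XD <-]; rewrite /left_kappa.
have [rB|rB] := eqVneq (\rank (diag_sqrt D *m A)) n; last first.
  by rewrite /kappa (negPf rB) leey.
have [a [b [/andP[a_gt0 ab] hab _ _ ->]]] := kappa_extreme n0 rB.
have b_gt0 : 0 < b by exact: lt_le_trans ab.
(* e / C turns the bound C of A into the perturbation e of b. *)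
have Jle e : 0 < e -> (J <= (Num.sqrt (a / (b + e)))^-1%:E)%E.
  move=> e0; pose D' := D + (e / C) *: 1%:M.
  have eC : 0 < e / C by rewrite divr_gt0.
  have XD' : posdef_diag D'.
    have /psd_diagP[d DE d0] := XD; apply/posdef_diagP.
    exists (d + const_mx (e / C)) => [|i]; last by rewrite !mxE ltr_wpDl.
    by rewrite /D' DE linearD /= diag_const_mx scalemx1.
  apply: (@le_trans _ _ (left_kappa A D')).
    by apply: ereal_inf_lbound; exact: imageP.
  apply: kappa_le => // x; have := hab x; have := hC x.
  rewrite -!mulmxA !normsq_diag_sqrt //; last exact: posdef_psd_diag.
  rewrite qformD qformZ qform1 => /andP[_ h1] /andP[h2 h3].
  apply/andP; split.
    by apply: le_trans h2 _; rewrite lerDl mulr_ge0 ?normsq_ge0 ?(ltW eC).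
  rewrite mulrDl lerD // mulrAC ler_pdivrMr // -mulrA ler_pM2l //.
  by rewrite mulrC.
have J1 := Jle _ ltr01.
case: J infJ Jle J1 => [r| |] //; rewrite !lee_fin => r0r Jle _.
have r_gt0 : 0 < r by exact: lt_le_trans ltr01 (le_trans r01 r0r).
rewrite le_inv_sqrt ?divr_gt0 // ler_pdivrMr // mulrC exprVn ler_pdivlMr ?exprn_gt0 //.
apply/ler_addgt0Pr => e e0; have := Jle e e0; have be : 0 < b + e by rewrite addr_gt0.
rewrite lee_fin le_inv_sqrt ?divr_gt0 // ler_pdivrMr // mulrC exprVn.
by rewrite ler_pdivlMr ?exprn_gt0.
Qed.

(** * The right problem *)

Lemma sum_basis_outer (R : realType) (n : nat) (d : 'rV[R]_n) :
  \sum_(i < n) d 0 i *: (std_basis R i *m (std_basis R i)^T) = diag_mx d.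
Proof.
rewrite diag_mx_sum_delta; apply: eq_bigr => i _; congr (_ *: _).
by rewrite /std_basis trmx_delta mul_delta_mx.
Qed.

Lemma right_feasibleP (R : realType) (m n : nat) (A : 'M[R]_(m, n)) (tau : R)
    (d : 'rV[R]_n) :
  right_feasible A tau d <->
  (forall x, tau * normsq (A *m x) <= qform (diag_mx d) x <= normsq (A *m x))
  /\ forall i, 0 <= d 0 i.
Proof.
rewrite /right_feasible sum_basis_outer.
have symM : (A^T *m A)^T = A^T *m A by rewrite trmx_mul trmxK.
have symS : (tau *: (A^T *m A) - diag_mx d)^T = tau *: (A^T *m A) - diag_mx d.
  by rewrite linearB linearZ /= symM tr_diag_mx.
have sym0 := trmx0 R n n; have symd := tr_diag_mx d.
split=> [[/(loewner_leP symd symM) h1 /(loewner_leP symS sym0) h2 d0]|[h d0]].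
  split=> // x; have := h1 x; have := h2 x.
  by rewrite qform0 qformB qformZ qform_gram subr_le0 => -> ->.
split=> //; apply/loewner_leP => // x.
  by rewrite qform_gram; case/andP: (h x).
by rewrite qform0 qformB qformZ qform_gram subr_le0; case/andP: (h x).
Qed.

(** The substitution x = D^(1/2) y, for which |x|^2 is the form of D at y. *)
Lemma right_sandwich (R : realType) (m n : nat) (A : 'M[R]_(m, n)) (D : 'M[R]_n)
    (a b : R) :
  posdef_diag D ->
  (forall x, a * normsq x <= normsq (A *m invmx (diag_sqrt D) *m x) <= b * normsq x)
  <-> (forall y, a * qform D y <= normsq (A *m y) <= b * qform D y).
Proof.
move=> XD; have uD := diag_sqrt_unit XD; have YD := posdef_psd_diag XD.
split=> h y.
  have := h (diag_sqrt D *m y).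
  by rewrite normsq_diag_sqrt // -mulmxA (mulmxA (invmx _)) mulVmx // mul1mx.
have := h (invmx (diag_sqrt D) *m y).
by rewrite -normsq_diag_sqrt // !mulmxA mulmxV // mul1mx.
Qed.

(** In contrast with the left problem, a feasible d with tau > 0 has no zero
    entry, since tau M <= diag d and M is positive definite; hence the transfer
    is directly to positive definite D. *)
Lemma right_transfer (R : realType) (m n : nat) (A : 'M[R]_(m, n)) :
  (0 < n)%N -> \rank A = n ->
  value_transfer (@posdef_diag R n) (right_kappa A) (right_feasible A).
Proof.
move=> n0 rA.
have [a0 [b0 [/andP[a0_gt0 ab0] hA _ _ _]]] := kappa_extreme n0 rA.
have b0_gt0 : 0 < b0 by exact: lt_le_trans ab0.
split.
- move=> D XD; rewrite /right_kappa.
  have [rB|rB] := eqVneq (\rank (A *m invmx (diag_sqrt D))) n; last first.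
    by left; rewrite /kappa (negPf rB).
  right; have [a [b [/andP[a_gt0 ab] hab _ _ kE]]] := kappa_extreme n0 rB.
  have b_gt0 : 0 < b by exact: lt_le_trans ab.
  have /posdef_diagP[d DE d0] := XD.
  (* Scaling by a makes the constraint diag d <= A^T A tight. *)
  exists (a / b), (a *: d), a^-1; split=> //.
  + by rewrite divr_gt0 //= ler_pdivrMr // mul1r.
  + apply/right_feasibleP; split=> [y|i]; last by rewrite mxE mulr_ge0 ?(ltW a_gt0) ?ltW.
    have /(right_sandwich _ _ _ XD)/(_ y)/andP[h1 h2] := hab.
    rewrite linearZ /= -DE qformZ h1 andbT -mulrA ler_pM2l //.
    by rewrite mulrC ler_pdivrMr // mulrC.
  + by rewrite invr_gt0.
  + by rewrite linearZ /= scalerA mulVf ?gt_eqF // scale1r -DE.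
- move=> tau d c t0 /right_feasibleP[hd d0] c0.
  have d_gt0 i : 0 < d 0 i.
    rewrite -qform_diag_delta; have /andP[h _] := hd (delta_mx i 0).
    apply: lt_le_trans h; rewrite pmulr_rgt0 // normsq_gt0; apply/eqP => Ae.
    have /matrixP/(_ i 0)/eqP : delta_mx i 0 = 0 :> 'cV[R]_n.
      by move/injective_full_rank: rA; apply.
    by rewrite !mxE !eqxx oner_eq0.
  have XD : posdef_diag (c *: diag_mx d).
    apply/posdef_diagP; exists (c *: d); first by rewrite linearZ.
    by move=> i; rewrite mxE mulr_gt0.
  split=> //; have -> : tau = c^-1 / (c * tau)^-1 by rewrite invrK mulKf ?gt_eqF.
  apply: kappa_le => //; first by rewrite invr_gt0.
  apply/right_sandwich => // y; have /andP[h1 h2] := hd y.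
  rewrite qformZ mulKf ?gt_eqF // h2 /= mulrC ler_pdivlMr ?mulr_gt0 //.
  by rewrite mulrCA ler_pM2l // mulrC.
- exists (a0 / b0), (const_mx a0); split; first by rewrite divr_gt0.
  apply/right_feasibleP; split=> [x|i]; last by rewrite mxE ltW.
  have /andP[h1 h2] := hA x.
  rewrite diag_const_mx -scalemx1 qformZ qform1 h1 andbT -mulrA ler_pM2l //.
  by rewrite mulrC ler_pdivrMr // mulrC.
Qed.

(** * Standard dual form *)

(** The sign constraint on d is itself a linear matrix inequality, namely
    diag d >= 0; the program built here has it as third block, of size p. *)
Lemma is_dual_sdp_lmi (R : realType) (n p : nat) (F : R -> 'rV[R]_p -> Prop)
    (C1 T1 C2 T2 : 'M[R]_n) (G1 G2 : 'I_p -> 'M[R]_n) :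
  C1^T = C1 -> T1^T = T1 -> (forall i, (G1 i)^T = G1 i) ->
  C2^T = C2 -> T2^T = T2 -> (forall i, (G2 i)^T = G2 i) ->
  (forall tau d, F tau d <->
     [/\ psd (C1 + tau *: T1 + \sum_i d 0 i *: G1 i),
         psd (C2 + tau *: T2 + \sum_i d 0 i *: G2 i)
       & forall i, 0 <= d 0 i]) ->
  is_dual_sdp F.
Proof.
move=> sC1 sT1 sG1 sC2 sT2 sG2 FE.
pose dim (k : nat) := match k with 0 => n | 1 => n | _ => p end.
pose const (k : nat) : 'M[R]_(dim k) :=
  match k with 0 => C1 | 1 => C2 | _ => 0 end.
pose coefT (k : nat) : 'M[R]_(dim k) :=
  match k with 0 => T1 | 1 => T2 | _ => 0 end.
pose coefG (k : nat) (i : 'I_p) : 'M[R]_(dim k) :=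
  match k with 0 => G1 i | 1 => G2 i | _ => delta_mx i i end.
pose coef (k : nat) (i : 'I_(1 + p)) : 'M[R]_(dim k) :=
  match fintype.split i with inl _ => coefT k | inr i => coefG k i end.
have const_sym (j : 'I_3) : (const j)^T = const j.
  by case: j => -[|[|[|//]]] ? //=; rewrite trmx0.
have coef_sym (j : 'I_3) i : (coef j i)^T = coef j i.
  rewrite /coef; case: (fintype.split i) => k; case: j => -[|[|[|//]]] ? //=.
    by rewrite trmx0.
  by rewrite trmx_delta.
have lmiE k tau d : const k
      + \sum_(i < 1 + p) (row_mx (tau%:M : 'M_1) d) 0 i *: coef k i
    = const k + tau *: coefT k + \sum_i d 0 i *: coefG k i.
  rewrite big_split_ord /= big_ord1 row_mxEl mxE eqxx mulr1n addrA.
  congr (_ + _ + _).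
    by rewrite /coef (unsplitK (inl _)).
  by apply: eq_bigr => i _; rewrite row_mxEr /coef (unsplitK (inr _)).
exists (DualSDP (delta_mx 0 0) const_sym coef_sym) => tau d /=; split.
  rewrite /sdp_objective big_split_ord /= big_ord1 big1 => [|i _].
    rewrite row_mxEl !mxE eqxx /= addr0.
    by rewrite mulr1n mul1r.
  by rewrite !mxE /= mul0r.
rewrite /sdp_feasible /= FE /loewner_le.
have nonnegE : psd (0 + tau *: 0 + \sum_i d 0 i *: delta_mx i i)
    <-> forall i, 0 <= d 0 i.
  rewrite scaler0 !add0r -diag_mx_sum_delta; split=> [pd|d0].
    have /psd_diagP[d' dd' d'0] : psd_diag (diag_mx d).
      by split=> //; exact: diag_mx_is_diag.
    by move=> i; rewrite -qform_diag_delta dd' qform_diag_delta.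
  by have [] : psd_diag (diag_mx d) by apply/psd_diagP; exists d.
split=> [h|[h1 h2 /nonnegE h3]].
  have := h (@Ordinal 3 0 isT); have := h (@Ordinal 3 1 isT).
  have := h (@Ordinal 3 2 isT).
  by rewrite !lmiE !subr0 /= => /nonnegE.
by case=> -[|[|[|//]]] ?; rewrite lmiE subr0.
Qed.

Lemma left_is_dual_sdp (R : realType) (m n : nat) (A : 'M[R]_(m, n)) :
  is_dual_sdp (left_feasible A).
Proof.
pose G (i : 'I_m) := (row i A)^T *m ((row i A)^T)^T.
have symG i : (G i)^T = G i by rewrite /G trmx_mul trmxK.
(* The blocks are S - tau I and I - S, with S the weighted sum of the G i. *)
apply: (@is_dual_sdp_lmi _ _ _ _ 0 (- 1%:M) 1%:M 0 G (fun i => - G i)).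
- by rewrite trmx0.
- by rewrite linearN /= trmx1.
- exact: symG.
- by rewrite trmx1.
- by rewrite trmx0.
- by move=> i; rewrite linearN /= symG.
move=> tau d; rewrite /left_feasible /loewner_le.
have -> : \sum_i d 0 i *: - G i = - \sum_i d 0 i *: G i.
  by rewrite -sumrN; apply: eq_bigr => i _; rewrite scalerN.
by rewrite add0r scalerN scaler0 addr0 addrC.
Qed.

Lemma right_is_dual_sdp (R : realType) (m n : nat) (A : 'M[R]_(m, n)) :
  is_dual_sdp (right_feasible A).
Proof.
pose G (i : 'I_n) := std_basis R i *m (std_basis R i)^T.
have symG i : (G i)^T = G i by rewrite /G trmx_mul trmxK.
have symM : (A^T *m A)^T = A^T *m A by rewrite trmx_mul trmxK.
(* The blocks are M - diag d and diag d - tau M, with M = A^T A. *)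
apply: (@is_dual_sdp_lmi _ _ _ _ (A^T *m A) 0 0 (- (A^T *m A)) (fun i => - G i) G).
- exact: symM.
- by rewrite trmx0.
- by move=> i; rewrite linearN /= symG.
- by rewrite trmx0.
- by rewrite linearN /= symM.
- exact: symG.
move=> tau d; rewrite /right_feasible /loewner_le.
have -> : \sum_i d 0 i *: - G i = - \sum_i d 0 i *: G i.
  by rewrite -sumrN; apply: eq_bigr => i _; rewrite scalerN.
by rewrite scaler0 addr0 !add0r opprB scalerN [- (tau *: _) + _]addrC.
Qed.

Theorem theorem2 (R : realType) (m n : nat) (A : 'M[R]_(m, n)) (n_gt0 : (0 < n)%N)
    (le_nm : (n <= m)%N) (rankA : \rank A = n) :
  (is_dual_sdp (left_feasible A)
   /\ is_dual_sdp (right_feasible A))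
  /\ (max_value (left_feasible A)
        = ((ereal_inf (left_kappa A @` @posdef_diag R m))^-1 ^+ 2)%E
      /\ max_value (right_feasible A)
        = ((ereal_inf (right_kappa A @` @posdef_diag R n))^-1 ^+ 2)%E)
  /\ (forall D1 : 'M[R]_m,
        minimizer (@psd_diag R m) (left_kappa A) D1
        <-> from_max_solution (left_feasible A) D1)
  /\ (forall D1 : 'M[R]_m,
        minimizer (@posdef_diag R m) (left_kappa A) D1
        <-> posdef_diag D1 /\ from_max_solution (left_feasible A) D1)
  /\ (forall D2 : 'M[R]_n,
        minimizer (@posdef_diag R n) (right_kappa A) D2
        <-> from_max_solution (right_feasible A) D2).
Proof.
have leftT := left_transfer n_gt0 rankA.
have rightT := right_transfer n_gt0 rankA.
have left_minE D : minimizer (@psd_diag R m) (left_kappa A) D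
    <-> from_max_solution (left_feasible A) D by exact: minimizer_transfer.
split; first by split; [exact: left_is_dual_sdp|exact: right_is_dual_sdp].
split; first by rewrite left_density //; split; exact: max_value_transfer.
split; first exact: left_minE.
split=> D; last exact: minimizer_transfer.
split=> [/minimizerE[XD]|[XD /left_minE/minimizerE[_ fD]]].
  rewrite left_density // => fD; split=> //.
  by apply/left_minE/minimizerE; split=> //; exact: posdef_psd_diag.
by apply/minimizerE; rewrite left_density.
Qed.
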